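(* In the setting and under the standing assumptions given in the context, let $H=V-G$ and $\mathcal D=\{x\in\mathbb R_+^2:H(x)=0\}$. Assume that $V$ is continuous, that for every $x_1\ge0$ the map $x_2\mapsto H(x_1,x_2)$ is nonincreasing on $[0,\infty)$, and that for every $x_1\ge0$ the section $\{x_2\ge0:(x_1,x_2)\in\mathcal D\}$ is nonempty, and let $b:[0,\infty)\to[0,\infty]$ be the function such that $\mathcal D=\{(x_1,x_2)\in\mathbb R_+^2:x_2\ge b(x_1)\}$. If, in addition, for every $x_2\ge0$ the map $x_1\mapsto H(x_1,x_2)$ is nondecreasing on $[0,\infty)$, then $b$ is nondecreasing. If instead for every $x_2\ge0$ the map $x_1\mapsto H(x_1,x_2)$ is nonincreasing on $[0,\infty)$, then $b$ is nonincreasing.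
   Context: Setting. $\mathbb R_+^2=[0,\infty)^2$; $(\Omega,\mathcal F,\mathbb F,\mathbb P)$ is a filtered probability space satisfying the usual conditions, $W$ a two-dimensional Brownian motion. $X$ is the normally reflected diffusion $dX_t=\beta(X_t)dt+\sigma(X_t)dW_t+dL_t$, $X_0=x\in\mathbb R_+^2$, where each $L^i$ $(i=1,2)$ is continuous, adapted, nondecreasing, $L^i_0=0$, $\int_0^\infty\mathbf 1_{\{X^i_s>0\}}dL^i_s=0$. Set $a=\sigma\sigma^\top$ and $\mathcal Lf=\beta\cdot\nabla f+\frac12\operatorname{Tr}(aD^2f)$. Let $\alpha>0$, $G(x)=x_1\vee\alpha x_2$. Standing assumptions. (A1) $\beta:\mathbb R_+^2\to\mathbb R^2$, $\sigma:\mathbb R_+^2\to\mathbb R^{2\times2}$ are continuous and locally Lipschitz, $|\beta(x)|+|\sigma(x)|\le K(1+|x|)$, $a$ is locally uniformly elliptic in $(0,\infty)^2$, and the reflected SDE has a unique strong solution for every $x\in\mathbb R_+^2$. (A2) $c:\mathbb R_+^2\to[0,\infty)$ is continuous with at most polynomial growth, $r>0$, and for every $x$, $\mathbb E_x[\int_0^\infty e^{-rs}c(X_s)ds]<\infty$ and $\mathbb E_x[\sup_{t\ge0}e^{-rt}G(X_t)]<\infty$. (A3) There are $\Psi\in C^2(\mathbb R_+^2)$, $K_\Psi,\lambda_\Psi>0$, $m\ge1$ with $1+|x|^m\le K_\Psi\Psi(x)$, $G(x)+c(x)\le K_\Psi\Psi(x)$, $\mathcal L\Psi\le\lambda_\Psi\Psi+K_\Psi$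 on $(0,\infty)^2$, and $r>\lambda_\Psi$. Value. $V(x)=\sup_{\tau\in\mathcal T}\mathbb E_x[e^{-r\tau}G(X_\tau)-\int_0^\tau e^{-rs}c(X_s)ds]$, $\mathcal T$ being all $\mathbb F$-stopping times, with $e^{-r\tau}G(X_\tau)=0$ on $\{\tau=\infty\}$. Since $\tau=0$ is admissible, $V\ge G$, so $H\ge0$. Under the first group of hypotheses of the claim such a function $b$ exists and is given by $b(x_1)=\inf\{x_2\ge0:H(x_1,x_2)=0\}$. *)

(* Defs.v *)
From HB Require Import structures.
From mathcomp Require Import all_boot all_order all_algebra.
From mathcomp Require Import all_classical all_reals all_analysis.

Set Implicit Arguments.
Unset Strict Implicit.
Unset Printing Implicit Defensive.

Import Order.TTheory GRing.Theory Num.Theory.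
Import numFieldNormedType.Exports.

Local Open Scope classical_set_scope.
Local Open Scope ring_scope.

(** Points of the plane are row vectors ['rV[R]_2]; the coordinates x_1, x_2
    are [x 0 0] and [x 0 1]. Functions on the closed quadrant are total
    functions on the plane, constrained only on the quadrant. The time axis
    [0, oo) is the set of nonnegative elements of [R]; values of processes at
    negative times are never used. *)

Definition quadrant {R : realType} : set 'rV[R]_2 :=
  [set x | forall i, 0 <= x 0 i].

Definition open_quadrant {R : realType} : set 'rV[R]_2 :=
  [set x | forall i, 0 < x 0 i].

Definition vec2 {R : realType} (x1 x2 : R) : 'rV[R]_2 :=
  \row_j (if j == 0 then x1 else x2).

(** The norm of the library on matrices is the sup norm; this is the Euclidean
    norm on row vectors (Frobenius norm on matrices). *)
Definition enorm {R : realType} m n (A : 'M[R]_(m, n)) : R :=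
  Num.sqrt (\sum_i \sum_j A i j ^+ 2).

Definition locally_lipschitz_on {R : realType} (V W : normedModType R)
    (A : set V) (f : V -> W) : Prop :=
  forall x, A x -> exists2 U, nbhs x U & [lipschitz f y | y in U `&` A].

Section differential_operators.
Context {R : realType}.
Implicit Types (f : 'rV[R]_2 -> R) (beta : 'rV[R]_2 -> 'rV[R]_2).

Definition partial (i : 'I_2) f : 'rV[R]_2 -> R :=
  fun x => 'D_(delta_mx 0 i) (f : 'rV[R]_2 -> R^o) x.

(** C^2 up to the boundary: the partial derivatives of order at most two exist
    in the interior and extend continuously to the closed quadrant. *)
Definition C2_quadrant f : Prop :=
  [/\ {within quadrant, continuous f},
      forall x i, open_quadrant x ->
        derivable (f : 'rV[R]_2 -> R^o) x (delta_mx 0 i) /\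
        forall j,
          derivable (partial i f : 'rV[R]_2 -> R^o) x (delta_mx 0 j),
      forall i, exists2 g : 'rV[R]_2 -> R, {within quadrant, continuous g} &
        {in open_quadrant, partial i f =1 g}
    & forall i j, exists2 g : 'rV[R]_2 -> R, {within quadrant, continuous g} &
        {in open_quadrant, partial j (partial i f) =1 g} ].

Definition hessian f (x : 'rV[R]_2) : 'M[R]_2 :=
  \matrix_(i, j) partial i (partial j f) x.

Definition diffusion_matrix (sigma : 'rV[R]_2 -> 'M[R]_2) (x : 'rV[R]_2) :
  'M[R]_2 := sigma x *m (sigma x)^T.

Definition generator beta (sigma : 'rV[R]_2 -> 'M[R]_2) f (x : 'rV[R]_2) : R :=
  \sum_i beta x 0 i * partial i f x +
  2^-1 * \tr (diffusion_matrix sigma x *m hessian f x).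

Definition locally_uniformly_elliptic (a : 'rV[R]_2 -> 'M[R]_2)
    (A : set 'rV[R]_2) : Prop :=
  forall C, compact C -> C `<=` A -> exists2 lambda, 0 < lambda &
    forall x (xi : 'rV[R]_2), C x ->
      lambda * enorm xi ^+ 2 <= (xi *m a x *m xi^T) 0 0.

End differential_operators.

Section stochastic_basis.
Context {d : measure_display} {Omega : measurableType d} {R : realType}.
Context (P : probability Omega R).
Implicit Types (F : R -> set (set Omega)) (Y I B : R -> Omega -> R)
  (W X L : R -> Omega -> 'rV[R]_2).

(** Since [F 0] consists of measurable sets, the last clause also says that
    the probability space is complete. *)
Definition usual_filtration F : Prop :=
  [/\ forall t, 0 <= t -> sigma_algebra [set: Omega] (F t),
      forall t, 0 <= t -> F t `<=` measurable,
      forall s t, 0 <= s -> s <= t -> F s `<=` F t,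
      forall t, 0 <= t -> F t = \bigcap_(u in [set u | t < u]) F u
    & forall N, P.-negligible N -> F 0 N ].

Definition measurable_wrt (G : set (set Omega)) (Z : Omega -> R) : Prop :=
  forall A : set R, measurable A -> G (Z @^-1` A).

Definition adapted F Y : Prop := forall t, 0 <= t -> measurable_wrt (F t) (Y t).

Definition adapted2 F X : Prop := forall i, adapted F (fun t w => X t w 0 i).

Definition continuous_path (T : topologicalType) (u : R -> T) : Prop :=
  {within `[0, +oo[, continuous u}.

(** The displayed identity expresses both that the increment is independent
    of [F s] and that it has the law N(0, (t - s) I_2); the second parameter
    of [normal_prob] is the standard deviation. *)
Definition brownian_motion2 F W : Prop :=
  [/\ adapted2 F W,
      {ae P, forall w, W 0 w = 0 /\ continuous_path (W ^~ w)}
    & forall s t, 0 <= s -> s < t ->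
      forall (A : set Omega) (B0 B1 : set R),
        F s A -> measurable B0 -> measurable B1 ->
        P (A `&` [set w | B0 (W t w 0 0 - W s w 0 0)]
             `&` [set w | B1 (W t w 0 1 - W s w 0 1)]) =
        (P A * normal_prob 0 (Num.sqrt (t - s)) B0
             * normal_prob 0 (Num.sqrt (t - s)) B1)%E ].

(** Elementary predictable integrands
    [\sum_(k < n) xi_k 1_{]t_k, t_(k+1)]}]. *)
Record elementary F := Elementary {
  el_size : nat;
  el_time : nat -> R;
  el_coef : nat -> Omega -> R;
  el_time_ge0 : 0 <= el_time 0%N;
  el_time_nd : forall k, el_time k <= el_time k.+1;
  el_coef_bounded : forall k, exists M, forall w, `|el_coef k w| <= M;
  el_coef_meas : forall k, measurable_wrt (F (el_time k)) (el_coef k) }.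

Definition el_val F (E : elementary F) : R -> Omega -> R := fun s w =>
  \sum_(k < el_size E) el_coef E k w * \1_(`]el_time E k, el_time E k.+1]) s.

Definition el_integral F (E : elementary F) B : R -> Omega -> R := fun t w =>
  \sum_(k < el_size E) el_coef E k w *
    (B (Num.min (el_time E k.+1) t) w - B (Num.min (el_time E k) t) w).

(** Convergence to 0 in probability, for nonnegative [Z n]. *)
Definition cvg_in_probability0 (Z : nat -> Omega -> \bar R) : Prop :=
  forall e : R, 0 < e ->
    (fun n => P [set w | (e%:E <= Z n w)%E]) @ \oo --> 0%E.

(** [I] is (a version of) the stochastic integral process of [Y] against the
    Brownian motion [B]: the limit, uniformly on compact time intervals in
    probability, of the integrals of elementary integrands approximating [Y]
    in L^2(0, T), in probability, for every [T]. *)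
Definition ito_integral F B Y I : Prop :=
  [/\ adapted F I,
      {ae P, forall w, continuous_path (I ^~ w)}
    & exists E : nat -> elementary F, forall T, 0 <= T ->
      cvg_in_probability0 (fun n w =>
        \int[lebesgue_measure]_(s in `[0%R, T])
          ((el_val (E n) s w - Y s w) ^+ 2)%:E)%E /\
      cvg_in_probability0 (fun n w =>
        ereal_sup [set (`|el_integral (E n) B t w - I t w|)%:E
                  | t in `[0, T]]) ].

(** [\int_0^oo 1_{y_s > 0} dl_s = 0], for the Lebesgue-Stieltjes measure of
    the nondecreasing path [l], extended by [l 0] to negative times. *)
Definition grows_only_at_zero (y l : R -> R) : Prop :=
  exists2 f : cumulative R R, (forall s, f s = l (Num.max 0 s)) &
    (\int[lebesgue_stieltjes_measure f]_(s in `[0%R, +oo[)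
       (\1_[set u | (0 < y u)%R] s)%:E = 0)%E.

Section reflected_sde.
Context (beta : 'rV[R]_2 -> 'rV[R]_2) (sigma : 'rV[R]_2 -> 'M[R]_2).

Definition reflected_solution F W (x : 'rV[R]_2) X L : Prop :=
  [/\ adapted2 F X, adapted2 F L
    & exists2 I : 'I_2 -> 'I_2 -> R -> Omega -> R,
      forall i j,
        ito_integral F (fun t w => W t w 0 j)
          (fun t w => sigma (X t w) i j) (I i j)
    & {ae P, forall w,
        [/\ X 0 w = x,
            continuous_path (X ^~ w),
            forall t, 0 <= t -> quadrant (X t w),
            (forall i, [/\ L 0 w 0 i = 0,
              continuous_path (fun t => L t w 0 i),
              {in `[0, +oo[ &, nondecreasing_fun (fun t => L t w 0 i)}
              & grows_only_at_zero (fun t => X t w 0 i) (fun t => L t w 0 i)])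
          & forall t i, 0 <= t ->
              X t w 0 i = x 0 i
                + \int[lebesgue_measure]_(s in `[0, t]) beta (X s w) 0 i
                + \sum_j I i j t w + L t w 0 i ]} ].

(** The P-augmentation of the filtration generated by [W]. *)
Definition brownian_filtration W (t : R) : set (set Omega) :=
  <<s [set A | P.-negligible A \/
        exists s i (B : set R), [/\ 0 <= s, s <= t, measurable B
          & A = (fun w => W s w 0 i) @^-1` B] ] >>.

Definition unique_strong_solution F W (x : 'rV[R]_2) : Prop :=
  (exists X L, [/\ reflected_solution F W x X L,
     adapted2 (brownian_filtration W) X & adapted2 (brownian_filtration W) L])
  /\
  (forall X L X' L',
     reflected_solution F W x X L -> reflected_solution F W x X' L' ->
     {ae P, forall w, forall t, 0 <= t -> X t w = X' t w /\ L t w = L' t w}).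

Definition assumption_A1 F W : Prop :=
  [/\ {within quadrant, continuous beta} /\
      {within quadrant, continuous sigma},
      locally_lipschitz_on quadrant beta /\
      locally_lipschitz_on quadrant sigma,
      exists K, forall x, quadrant x ->
        enorm (beta x) + enorm (sigma x) <= K * (1 + enorm x),
      locally_uniformly_elliptic (diffusion_matrix sigma) open_quadrant
    & forall x, quadrant x -> unique_strong_solution F W x ].

End reflected_sde.

Section stopping_problem.
Context (X : 'rV[R]_2 -> R -> Omega -> 'rV[R]_2).
Context (G c : 'rV[R]_2 -> R) (r : R).

Definition assumption_A2 : Prop :=
  [/\ forall x, quadrant x -> 0 <= c x,
      {within quadrant, continuous c},
      exists C (p : nat), forall x, quadrant x -> c x <= C * (1 + enorm x ^+ p),
      0 < r
    & forall x, quadrant x ->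
      (\int[P]_w \int[lebesgue_measure]_(s in `[0%R, +oo[)
         (expR (- r * s) * c (X x s w))%:E < +oo)%E /\
      (\int[P]_w ereal_sup
         [set (expR (- r * t) * G (X x t w))%:E | t in `[0%R, +oo[] < +oo)%E ].

Definition assumption_A3 (beta : 'rV[R]_2 -> 'rV[R]_2)
    (sigma : 'rV[R]_2 -> 'M[R]_2) : Prop :=
  exists (Psi : 'rV[R]_2 -> R) (K lambda m : R),
  [/\ C2_quadrant Psi,
      [/\ 0 < K, 0 < lambda & 1 <= m],
      forall x, quadrant x ->
        1 + enorm x `^ m <= K * Psi x /\ G x + c x <= K * Psi x,
      forall x, open_quadrant x ->
        generator beta sigma Psi x <= lambda * Psi x + K
    & lambda < r ].

Definition stopping_time F (tau : Omega -> \bar R) : Prop :=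
  (forall w, (0 <= tau w)%E) /\
  (forall t, 0 <= t -> F t [set w | (tau w <= t%:E)%E]).

Definition reward (tau : Omega -> \bar R) (x : 'rV[R]_2) (w : Omega) : \bar R :=
  ((if tau w is s%:E then expR (- r * s) * G (X x s w) else 0)%R%:E -
   \int[lebesgue_measure]_(s in [set s | (0 <= s)%R /\ s%:E <= tau w])
     (expR (- r * s) * c (X x s w))%:E)%E.

Definition value_function F (x : 'rV[R]_2) : \bar R :=
  ereal_sup [set (\int[P]_w reward tau x w)%E | tau in stopping_time F].

Definition excess F (x : 'rV[R]_2) : \bar R := (value_function F x - (G x)%:E)%E.

Definition stopping_region F : set 'rV[R]_2 :=
  [set x | quadrant x /\ excess F x = 0%E].

End stopping_problem.

End stochastic_basis.

Definition gain {R : realType} (alpha : R) (x : 'rV[R]_2) : R :=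
  Num.max (x 0 0) (alpha * x 0 1).

(* Main.v *)
(** The stopping time [tau = 0] is admissible, so [H >= 0] on the quadrant. If
    [H (x1, x2)] is monotone in [x1], a zero of [H] therefore propagates along
    horizontal lines in the direction in which [H] decreases, and applying this
    at the boundary point [(y1, b y1)] compares the values of [b]. *)
Require Import Defs.
From HB Require Import structures.
From mathcomp Require Import all_boot all_order all_algebra.
From mathcomp Require Import all_classical all_reals all_analysis.
From mathcomp Require Import measurable_realfun.

Import Order.TTheory GRing.Theory Num.Theory.
Import numFieldNormedType.Exports.

Local Open Scope classical_set_scope.
Local Open Scope ring_scope.

Lemma vec2_0 (R : realType) (x y : R) : vec2 x y 0 0 = x.
Proof. by rewrite mxE eqxx. Qed.

Lemma vec2_1 (R : realType) (x y : R) : vec2 x y 0 1 = y.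
Proof. by rewrite mxE. Qed.

Lemma quadrant_vec2 (R : realType) (x y : R) :
  0 <= x -> 0 <= y -> quadrant (vec2 x y).
Proof. by move=> x0 y0 i; rewrite mxE; case: ifP. Qed.

Lemma stopping_time0 (d : measure_display) (Omega : measurableType d)
    (R : realType) (P : probability Omega R) (F : R -> set (set Omega)) :
  usual_filtration P F -> stopping_time F (cst 0%E).
Proof.
move=> [Fs _ _ _ _]; split=> [w|t t0]; first exact: lexx.
have [F0 FC _] := Fs t t0.
(* The event is the whole space, which a sigma-algebra contains as the complement of the empty
   set. *)
suff -> : [set w : Omega | (cst 0 w <= t%:E)%E] = setT `\` set0 by exact: FC.
by rewrite setD0; apply/seteqP; split=> w // _ /=; rewrite lee_fin.
Qed.

Lemma adapted_measurable (d : measure_display) (Omega : measurableType d)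
    (R : realType) (P : probability Omega R) (F : R -> set (set Omega))
    (Y : R -> Omega -> R) (t : R) :
  usual_filtration P F -> adapted F Y -> 0 <= t -> measurable_fun setT (Y t).
Proof.
move=> [_ Fm _ _ _] FY t0 _ A mA; rewrite setTI.
by apply: (Fm t t0); exact: FY.
Qed.

Lemma measurable_gain (d : measure_display) (Omega : measurableType d)
    (R : realType) (alpha : R) (Z : Omega -> 'rV[R]_2) :
  (forall i, measurable_fun setT (fun w => Z w 0 i)) ->
  measurable_fun setT (fun w => gain alpha (Z w)).
Proof.
by move=> mZ; apply: measurable_maxr => //; exact: measurable_funM.
Qed.

Lemma reward0 (d : measure_display) (Omega : measurableType d) (R : realType)
    (X : 'rV[R]_2 -> R -> Omega -> 'rV[R]_2) (G c : 'rV[R]_2 -> R) (r : R)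
    (x : 'rV[R]_2) (w : Omega) :
  reward X G c r (cst 0%E) x w = (G (X x 0 w))%:E.
Proof.
rewrite /reward /= mulr0 expR0 mul1r.
(* The running cost is integrated over the times [0 <= s <= 0], a Lebesgue-null singleton, so it
   vanishes for every [w]. *)
rewrite [X in integral _ X _](_ : _ = [set 0]).
  by rewrite integral_set1 sube0.
apply/seteqP; split=> [s [s0]|s ->] //=; rewrite lee_fin => s0'.
by apply/eqP; rewrite eq_le s0 s0'.
Qed.

(** Stopping at once pays [G (X_0)]. Since [X_0 = x] holds only almost surely, the expectation is
    found by almost-everywhere equality with a constant; the measurability this needs comes from
    adaptedness at time 0. *)
Lemma gain_le_value (d : measure_display) (Omega : measurableType d)
    (R : realType) (P : probability Omega R) (F : R -> set (set Omega))
    (W : R -> Omega -> 'rV[R]_2)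
    (beta : 'rV[R]_2 -> 'rV[R]_2) (sigma : 'rV[R]_2 -> 'M[R]_2)
    (X : 'rV[R]_2 -> R -> Omega -> 'rV[R]_2) (L : R -> Omega -> 'rV[R]_2)
    (c : 'rV[R]_2 -> R) (r alpha : R) (x : 'rV[R]_2) :
  usual_filtration P F ->
  reflected_solution P beta sigma F W x (X x) L ->
  ((gain alpha x)%:E <= value_function P X (gain alpha) c r F x)%E.
Proof.
move=> uF [aX _ [I _ aeX]]; apply: ereal_sup_ubound.
exists (cst 0%E); first exact: stopping_time0 uF.
under eq_integral do rewrite reward0.
have mG : measurable_fun setT (fun w => (gain alpha (X x 0 w))%:E).
  apply/measurable_EFinP/measurable_gain => i.
  exact: adapted_measurable uF (aX i) (lexx 0).
have aeG : ae_eq P setT (fun w => (gain alpha (X x 0 w))%:E)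
    (cst (gain alpha x)%:E).
  by apply: filterS aeX => w [-> _ _ _ _].
rewrite (ae_eq_integral _ _ measurableT mG (measurable_cst _) aeG).
by rewrite integral_cst //= probability_setT mule1.
Qed.

(** No order between [x1] and [y1] is assumed, only the comparison of [H] on the two vertical lines,
    so that the lemma serves both monotonicity cases. *)
Lemma le_boundary (R : realType) (H : 'rV[R]_2 -> \bar R) (b : R -> \bar R)
    (x1 y1 : R) :
  (forall x, quadrant x -> (0 <= H x)%E) ->
  [set x | quadrant x /\ H x = 0%E] =
    [set x | quadrant x /\ (b (x 0 0)%R <= (x 0 1)%R%:E)%E] ->
  0 <= x1 -> 0 <= y1 -> (0 <= b y1)%E ->
  (forall x2, 0 <= x2 -> (H (vec2 x1 x2) <= H (vec2 y1 x2))%E) ->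
  (b x1 <= b y1)%E.
Proof.
move=> H0 /seteqP[Db bD] x10 y10.
(* The value [-oo] contradicts [0 <= b y1] and [+oo] bounds everything; only a finite height gives a
   boundary point. *)
case by1 : (b y1) => [y2| |] by10 Hle //; last exact: leey.
have y20 : 0 <= y2 by rewrite -lee_fin.
(* The boundary point itself lies in the region, because the inequality describing it is not
   strict. *)
have [_ Hy] : quadrant (vec2 y1 y2) /\ H (vec2 y1 y2) = 0%E.
  apply: bD; split; first exact: quadrant_vec2.
  by rewrite vec2_0 vec2_1 by1.
have qx : quadrant (vec2 x1 y2) by exact: quadrant_vec2.
have [|_] := Db (vec2 x1 y2); last by rewrite vec2_0 vec2_1.
(* Squeeze: [0 <= H (x1, y2) <= H (y1, y2) = 0]. *)
by split=> //; apply/eqP; rewrite eq_le H0 // -Hy Hle.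
Qed.

Theorem corollary4p4 (d : measure_display) (Omega : measurableType d)
  (R : realType) (P : probability Omega R) (F : R -> set (set Omega))
  (W : R -> Omega -> 'rV[R]_2)
  (beta : 'rV[R]_2 -> 'rV[R]_2) (sigma : 'rV[R]_2 -> 'M[R]_2)
  (X L : 'rV[R]_2 -> R -> Omega -> 'rV[R]_2)
  (c : 'rV[R]_2 -> R) (r alpha : R) (b : R -> \bar R)
  (G := gain alpha) (V := value_function P X G c r F) (H := excess P X G c r F)
  (D := stopping_region P X G c r F) :
  usual_filtration P F ->
  brownian_motion2 P F W ->
  0 < alpha ->
  assumption_A1 P beta sigma F W ->
  (forall x, quadrant x ->
     reflected_solution P beta sigma F W x (X x) (L x)) ->
  assumption_A2 P X G c r ->
  assumption_A3 G c r beta sigma ->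
  {within quadrant, continuous V} ->
  (forall x1 : R, 0 <= x1 ->
     {in `[0, +oo[ &, nonincreasing_fun (fun x2 => H (vec2 x1 x2))}) ->
  (forall x1 : R, 0 <= x1 -> exists2 x2 : R, 0 <= x2 & D (vec2 x1 x2)) ->
  (forall x1 : R, 0 <= x1 -> (0 <= b x1)%E) ->
  D = [set x | quadrant x /\ (b (x 0 0)%R <= (x 0 1)%R%:E)%E] ->
  ((forall x2 : R, 0 <= x2 ->
      {in `[0, +oo[ &, nondecreasing_fun (fun x1 => H (vec2 x1 x2))}) ->
   {in `[0, +oo[ &, nondecreasing_fun b}) /\
  ((forall x2 : R, 0 <= x2 ->
      {in `[0, +oo[ &, nonincreasing_fun (fun x1 => H (vec2 x1 x2))}) ->
   {in `[0, +oo[ &, nonincreasing_fun b}).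
Proof.
move=> uF _ _ _ sol _ _ _ _ _ b0 Db.
have H0 x : quadrant x -> (0 <= H x)%E.
  by move=> qx; rewrite sube_ge0 //; exact: gain_le_value uF (sol x qx).
(* Both goals read [b x1 <= b y1], with [x1 <= y1] in the first case and [y1 <= x1] in the second;
   either way [mono] gives [H (x1, x2) <= H (y1, x2)]. *)
by split=> mono x1 y1; rewrite !in_itv /= !andbT => x10 y10 xy;
  apply: le_boundary H0 Db _ _ _ _ => //; do ?[exact: b0] => x2 x20;
  apply: mono => //; rewrite in_itv /= andbT.
Qed.
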